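(* Assume $\mathsf{MA}(\sigma\text{-linked})$. Then there exists a non-scattered Laver ultrafilter, i.e., a Laver ultrafilter that is not a scattered ultrafilter.
   Context: By an ultrafilter we always mean a non-principal ultrafilter. Laver ultrafilter: an ultrafilter $\mathcal{U}$ over $\omega$ is a Laver ultrafilter if for every sequence $\langle \mathcal{P}_n : n\in\omega\rangle$, where each $\mathcal{P}_n$ is a partition of $\omega$ into finitely many sets, there exists $x\in\mathcal{U}$ such that for all $n\in\omega$, $x$ has non-empty intersection with at most $n+1$ elements of $\mathcal{P}_n$. Scattered ultrafilter: a subset of $2^\omega$ is scattered if each of its nonempty subsets has an isolated point (in the relative topology). An ultrafilter $\mathcal{U}$ over $\omega$ is a scattered ultrafilter if for every $F:\omega\to 2^\omega$ there is $x\in\mathcal{U}$ such that $F[x]$ is scattered. $\mathsf{MA}(\sigma\text{-linked})$: for every $\sigma$-linked partial order $\mathbb{P}$ (a countable union of sets of pairwise compatible conditions) and every family $\mathcal{D}$ of fewer than $\mathfrak{c}$ dense subsets of $\mathbb{P}$, there is a filter $G\subseteq\mathbb{P}$ meeting every member of $\mathcal{D}$. *)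

(* Defs.v *)
From HB Require Import structures.
From mathcomp Require Import all_boot all_order.
From mathcomp Require Import boolp classical_sets functions cardinality filter.
From mathcomp Require Import topology cantor.

Set Implicit Arguments.
Unset Strict Implicit.
Unset Printing Implicit Defensive.

Import Order.TTheory.

Local Open Scope classical_set_scope.
Local Open Scope card_scope.

Section Forcing.
Context {d : Order.disp_t} {P : porderType d}.
Local Open Scope order_scope.

(* Smaller conditions are stronger. *)
Definition compatible (p q : P) : Prop := exists r : P, r <= p /\ r <= q.

Definition linked (A : set P) : Prop :=
  forall p q : P, A p -> A q -> compatible p q.

Definition dense_subset (D : set P) : Prop :=
  forall p : P, exists2 q : P, D q & q <= p.

Definition forcing_filter (G : set P) : Prop :=
  [/\ G !=set0,
      forall p q : P, G p -> p <= q -> G q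
    & forall p q : P, G p -> G q -> exists2 r : P, G r & r <= p /\ r <= q].

End Forcing.

Definition sigma_linked (d : Order.disp_t) (P : porderType d) : Prop :=
  exists2 A : nat -> set P,
    forall n : nat, linked (A n) & \bigcup_n A n = [set: P].

Definition card_lt_continuum (T : Type) (D : set T) : Prop :=
  D #<= [set: cantor_space] /\ ~ ([set: cantor_space] #<= D).

(* As usual in forcing, partial orders are nonempty: the empty one is
   sigma-linked but has no (nonempty) filter. *)
Definition MA_sigma_linked : Prop :=
  forall (d : Order.disp_t) (P : porderType d),
    [set: P] !=set0 -> sigma_linked P ->
    forall D : set (set P),
      card_lt_continuum D -> (forall E : set P, D E -> dense_subset E) ->
      exists2 G : set P,
        forcing_filter G & forall E : set P, D E -> G `&` E !=set0.

Definition nonprincipal_ultrafilter (U : set_system nat) : Prop :=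
  UltraFilter U /\ forall n : nat, ~ U [set n].

Definition finite_partition (Q : set (set nat)) : Prop :=
  finite_set Q /\ partition Q id [set: nat].

Definition laver_ultrafilter (U : set_system nat) : Prop :=
  nonprincipal_ultrafilter U /\
  forall Q : nat -> set (set nat), (forall n : nat, finite_partition (Q n)) ->
    exists2 x : set nat, U x &
      forall n : nat, [set a | Q n a /\ x `&` a !=set0] #<= `I_n.+1.

Definition scattered (S : set cantor_space) : Prop :=
  forall A : set cantor_space, A `<=` S -> A !=set0 -> isolated A !=set0.

Definition scattered_ultrafilter (U : set_system nat) : Prop :=
  nonprincipal_ultrafilter U /\
  forall F : nat -> cantor_space, exists2 x : set nat, U x & scattered (F @` x).

(* Main.v *)
Require Import Defs.
From HB Require Import structures.
From mathcomp Require Import all_boot all_order classical_sets filter.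
From mathcomp Require Import boolp functions cardinality topology cantor wochoice.
From mathcomp Require Import zify.

(** Binary expansion embeds omega into the Cantor space as a countable set
without isolated points.  Call a set of natural numbers fat when its image is
not scattered, that is, when it contains a nonempty crowded set.  A union of
two sets that are not fat is not fat, so a directed family of fat sets extends
to an ultrafilter of fat sets ([ultrafilter_of_fat]); such an ultrafilter is
nonprincipal, and the binary embedding witnesses that it is not scattered.  It
therefore suffices to build a tower of sets, all of whose finite intersections
are fat, which contains for each sequence of finite partitions a set meeting
at most [n + 1] blocks of the [n]-th one.

The tower is built by recursion of length continuum.  A stage faces fewer than
continuum many sets with fat finite intersections and one sequence [c] of
finite colourings, and needs a set [x] that has at most [n + 1] colours under
[c n], for every [n], and whose trace on each finite intersection is still fat
([laver_extension]).  Such an [x] is generic for a sigma-linked order.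

The difficulty is that [x] must contain crowded subsets of all the old sets
[A], and different points of [x] may be forced to have different colours.  A
condition is a finite set of promises [(p, A, g)]: the point [p] is put into
[x], and further points of [A] that tend to [p] will be added, with colours
following the branch [g].  Compactness supplies [g] ([fat_branch]): in every
neighbourhood of [p], the points of [A] following [g] up to any given level
form a fat set.  A condition also records a level [m] below which every new
point and every new branch has to follow one that is already there.  Hence the
number of colours below [m] is frozen, and since [m] exceeds a multiple of the
number of promises, there is always room for new colours above [m].  Two
conditions with the same points, the same level and the same branches below
that level have a common extension, namely their union; there are countably
many such patterns, so the order is sigma-linked ([condition_code_linked]).
New points may be added near old ones by [extend_condition], so that genericity
makes the points promised for each [A] a crowded set.

Two facts about cardinals make the counting work: an infinite set has as many
finite sequences as elements ([embeds_seq]), so that fewer than continuum many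
sets have fewer than continuum many finite intersections; and continuum many
stages may be well-ordered with all proper initial segments smaller than the
continuum ([embeds_small_segments]). *)

Set Implicit Arguments.
Unset Strict Implicit.
Unset Printing Implicit Defensive.

Local Open Scope classical_set_scope.


(** * A countable crowded subspace of the Cantor space *)

Definition bits (n : nat) : cantor_space := fun k => odd (iter k half n).

(** The basic neighbourhoods of the topology that [bits] induces on the natural
numbers: congruence modulo [2 ^ l]. *)
Definition near_upto (l m n : nat) : Prop :=
  forall k, (k < l)%N -> bits m k = bits n k.

Lemma bitsS n k : bits n k.+1 = bits n./2 k.
Proof. by rewrite /bits iterSr. Qed.

Lemma near_uptoxx l n : near_upto l n n.
Proof. by []. Qed.

Lemma near_upto_trans l n m p :
  near_upto l m n -> near_upto l n p -> near_upto l m p.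
Proof. by move=> mn np k kl; rewrite mn// np. Qed.

Lemma near_upto_le l l' m n : (l <= l')%N -> near_upto l' m n -> near_upto l m n.
Proof. by move=> ll' mn k kl; apply: mn; apply: leq_trans ll'. Qed.

Lemma bits_inj : injective bits.
Proof.
move=> m n; have [b] := ubnP (m + n); elim: b m n => // b IH m n mnb mn.
have [/eqP|mn0] := posnP (m + n); first by rewrite addn_eq0 => /andP[/eqP-> /eqP->].
have omn : odd m = odd n := congr1 (fun f : cantor_space => f 0) mn.
have h : m./2 = n./2.
  by apply: IH; [lia|apply/funext => k; rewrite -!bitsS mn].
by rewrite -(odd_double_half m) -(odd_double_half n) omn h.
Qed.

Lemma near_upto_sep m n : m <> n -> exists l, ~ near_upto l m n.
Proof.
move=> mn; apply: contrapT => /forallNP near; apply: mn; apply: bits_inj.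
by apply/funext => k; have /contrapT := near k.+1; apply.
Qed.

(** Flipping a binary digit of index at least [l] moves a number without leaving
its neighbourhood. *)
Lemma near_upto_ex l n : exists2 m, m <> n & near_upto l m n.
Proof.
elim: l n => [n|l IH n]; first by exists n.+1; [lia|].
have [m mn near] := IH n./2; exists (odd n + m.*2)%N.
  by move=> e; apply: mn; move/(congr1 half): e; rewrite half_bit_double.
case=> [_|k kl]; first by rewrite /bits/= oddD odd_double addbF oddb.
by rewrite !bitsS half_bit_double near.
Qed.

(** The topology of the Cantor space is that of pointwise convergence, and the
filter of the images of the sets [near_upto l _ n] converges pointwise to
[bits n]. *)
Lemma nbhs_bits n V : nbhs (bits n : cantor_space) V ->
  exists l, forall m, near_upto l m n -> V (bits m).
Proof.
pose F : set_system cantor_space :=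
  filter_from [set: nat] (fun l => [set bits m | m in [set m | near_upto l m n]]).
have FF : Filter F.
  apply: filter_from_filter; first by exists 0%N.
  move=> i j _ _; exists (maxn i j) => // _ [m /= mn <-].
  by split; exists m => //; apply: near_upto_le mn; rewrite ?leq_maxl ?leq_maxr.
have cvgF : {ptws, F --> (bits n : nat -> bool)}.
  apply/pointwise_cvgP => k A; rewrite /= => nA.
  exists k.+1 => // _ [m /= mn <-] /=; rewrite mn//.
  exact: (nbhs_singleton nA).
move=> nV; have [l _ lV] := cvgF V nV.
by exists l => m mn; apply: lV; exists m.
Qed.

(** * The ideal of sets with scattered image *)

Definition crowded (C : set nat) : Prop :=
  forall n l, C n -> exists2 m, m <> n & near_upto l m n /\ C m.

Definition fat (A : set nat) : Prop :=
  exists2 C, crowded C & C !=set0 /\ C `<=` A.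

Lemma fatS A B : A `<=` B -> fat A -> fat B.
Proof. by move=> AB [C cC [C0 CA]]; exists C => //; split => // n /CA/AB. Qed.

Lemma fatT : fat setT.
Proof.
by exists setT; [move=> n l _; have [m] := near_upto_ex l n; exists m | split=> //; exists 0%N].
Qed.

Lemma fat_nonempty A : fat A -> A !=set0.
Proof. by move=> [C _ [[n Cn] CA]]; exists n; exact: CA. Qed.

(** If a crowded subset of the union meets [A] in a set that is not crowded, an
isolated point of that trace has a neighbourhood in which all other points of
the crowded set lie in [B]; they form a crowded set, because removing a point
leaves a relatively open set. *)
Lemma fatU A B : fat (A `|` B) -> fat A \/ fat B.
Proof.
move=> [C cC [[n0 Cn0] CAB]].
have [nA|] := pselect (~ fat A); last by move=> /contrapT; left.
right; have [CA0|/set0P/negP/negPn/eqP CA0] := pselect ((C `&` A) !=set0); last first.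
  exists C => //; split; first by exists n0.
  move=> n Cn; have [An|//] := CAB n Cn.
  by have : (C `&` A) n by []; rewrite CA0.
have : ~ crowded (C `&` A).
  by move=> cCA; apply: nA; exists (C `&` A) => //; split=> // ? [].
move=> /existsNP[n /existsNP[l /not_implyP[[Cn An] iso]]].
exists [set m | C m /\ m <> n /\ near_upto l m n].
  (* A level beyond [k'] separates the new point from the removed point [n]. *)
  move=> m k /= [Cm [mn near]]; have [k' sep] := near_upto_sep mn.
  have [m' m'm [near' Cm']] := cC m (maxn l (maxn k k')) Cm.
  exists m' => //; split; first by apply: near_upto_le near'; lia.
  split=> //; split; last first.
    by apply: near_upto_trans near; apply: near_upto_le near'; lia.
  move=> m'n; apply: sep; rewrite -m'n => i ik; apply/esym/near'; lia.
split.
  by have [m mn [near Cm]] := cC n l Cn; exists m.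
move=> m [Cm [mn near]]; have [Am|//] := CAB m Cm.
by exfalso; apply: iso; exists m.
Qed.

Lemma fat1N n : ~ fat [set n].
Proof.
move=> [C cC [[m Cm] Cn]]; have [m' m'm [_ /Cn]] := cC m 0%N Cm.
by move=> /= e; apply: m'm; rewrite e (Cn m Cm).
Qed.

Lemma crowded_fat_near C p l : crowded C -> C p -> fat (C `&` [set q | near_upto l q p]).
Proof.
move=> cC Cp; exists (C `&` [set q | near_upto l q p]); last first.
  by split=> //; exists p; split=> //; exact: near_uptoxx.
move=> q k [Cq /= near]; have [m mq [near' Cm]] := cC q (maxn k l) Cq.
exists m => //; split; first by apply: near_upto_le near'; lia.
by split=> //=; apply: near_upto_trans near; apply: near_upto_le near'; lia.
Qed.

(** A crowded set has a relatively crowded image, which no scattered set contains. *)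
Lemma scattered_not_fat A : scattered (bits @` A) -> ~ fat A.
Proof.
move=> sc [C cC [[n0 Cn0] CA]].
have [||f [/set_mem[n Cn <-] [V nV VC]]] := sc (bits @` C).
- by move=> _ [m /CA Am <-]; exists m.
- by exists (bits n0), n0.
have [l lV] := nbhs_bits nV.
have [m mn [near Cm]] := cC n l Cn.
have : (V `&` (bits @` C)) (bits m) by split; [exact: lV|exists m].
by rewrite VC => /bits_inj.
Qed.

(** The sets that contain a member of [B] up to a set that is not fat form a
proper filter.  It contains the complement of every set that is not fat, so
every ultrafilter that refines it consists of fat sets. *)
Lemma ultrafilter_of_fat (B : set (set nat)) :
    B !=set0 -> (forall b, B b -> fat b) ->
    (forall b b', B b -> B b' -> exists2 d, B d & d `<=` b `&` b') ->
  exists U : set_system nat, [/\ UltraFilter U, B `<=` U & U `<=` fat].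
Proof.
move=> [b0 Bb0] Bfat Bdir.
pose F : set_system nat := [set D | exists2 b, B b & ~ fat (b `\` D)].
have FF : ProperFilter F.
  split; first by move=> [b Bb]; rewrite setD0; apply; exact: Bfat.
  split.
  - by exists b0 => //; rewrite setDT => /fat_nonempty[].
  - move=> D D' [b Bb bD] [b' Bb' bD']; have [d Bd dbb'] := Bdir _ _ Bb Bb'.
    exists d => // fd; have [/bD|/bD'] // : fat (b `\` D) \/ fat (b' `\` D').
    apply: fatU; apply: fatS fd => n [/dbb'[bn b'n] /not_andP[Dn|D'n]].
      by left.
    by right.
  - move=> D D' DD' [b Bb bD]; exists b => // fb; apply: bD.
    by apply: fatS fb => n [bn D'n]; split=> // /DD'.
have [U [UU FU]] := ultraFilterLemma FF; exists U; split=> //.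
  by move=> b Bb; apply: FU; exists b => //; rewrite setDv => /fat_nonempty[].
move=> D UD; apply: contrapT => nD.
have UC : U (~` D).
  by apply: FU; exists b0 => // fb; apply: nD; apply: fatS fb => n [_ /contrapT].
by have /filter_ex[n []] : U (D `&` ~` D) by exact: filterI.
Qed.

(** * Branches through a sequence of colourings *)

Definition agree (m : nat) (h h' : nat -> nat) : Prop :=
  forall n, (n < m)%N -> h n = h' n.

Lemma agree_sym m h h' : agree m h h' -> agree m h' h.
Proof. by move=> hh' n nm; rewrite hh'. Qed.

Lemma agree_trans m h1 h2 h3 : agree m h1 h2 -> agree m h2 h3 -> agree m h1 h3.
Proof. by move=> a b n nm; rewrite a// b. Qed.

Lemma agree_le m m' h h' : (m <= m')%N -> agree m' h h' -> agree m h h'.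
Proof. by move=> mm' hh' n nm; apply: hh'; apply: leq_trans mm'. Qed.

Definition bounded_colouring (c : nat -> nat -> nat) : Prop :=
  forall n, exists b, forall k, (c n k < b)%N.

Lemma ultra_colour (U : set_system nat) (c : nat -> nat) b :
  UltraFilter U -> (forall k, (c k < b)%N) -> exists i, U [set k | c k = i].
Proof.
move=> UU cb; apply: contrapT => /forallNP nU.
suff : U [set k | (b <= c k)%N].
  by move=> /filter_ex[k /=]; rewrite leqNgt cb.
elim: b {cb} => [|b IH]; first by apply: filterS filterT.
have [/nU//|UC] := in_ultra_setVsetC [set k | c k = b] UU.
by apply: filterS (filterI IH UC) => k [/= bk /eqP kb]; rewrite ltn_neqAle eq_sym kb.
Qed.

(** An ultrafilter of fat sets that contains [B] picks one colour of each
colouring, and these colours form the branch. *)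
Lemma fat_branch (B : set (set nat)) (c : nat -> nat -> nat) :
    B !=set0 -> (forall b, B b -> fat b) ->
    (forall b b', B b -> B b' -> exists2 d, B d & d `<=` b `&` b') ->
    bounded_colouring c ->
  exists g, forall b m, B b -> fat (b `&` [set k | agree m (c^~ k) g]).
Proof.
move=> B0 Bfat Bdir cb; have [U [UU BU Ufat]] := ultrafilter_of_fat B0 Bfat Bdir.
have /choice[g Ug] : forall n, exists i, U [set k | c n k = i].
  by move=> n; have [b] := cb n; apply: ultra_colour.
exists g => b m Bb; apply: Ufat; apply: filterI; first exact: BU.
elim: m => [|m IH]; first by apply: filterS filterT.
apply: filterS (filterI IH (Ug m)) => k [/= ag e] n.
by rewrite ltnS leq_eqVlt => /predU1P[->//|]; exact: ag.
Qed.


(** * Finite sequences over an infinite set *)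

Definition embeds (T U : Type) : Prop := exists f : T -> U, injective f.

Lemma embeds_trans T U V : embeds T U -> embeds U V -> embeds T V.
Proof. by move=> [f fi] [g gi]; exists (g \o f); exact: inj_comp. Qed.

(** A maximal partial injection is total on one side. *)
Lemma embeds_total T U : embeds T U \/ embeds U T.
Proof.
pose P (M : set (T * U)) :=
  forall a b, M a -> M b -> a.1 = b.1 <-> a.2 = b.2.
have [|M [PM maxM]] := @Zorn_bigcup (T * U)%type P.
  move=> F FP totF a b [X FX Xa] [Y FY Yb].
  have [XY|YX] := totF X Y FX FY; [apply: (FP Y FY) => //; exact: XY|].
  by apply: (FP X FX) => //; exact: YX.
have [domM|/existsNP[t tM]] := pselect (forall t, exists u, M (t, u)).
  left; have [f fM] := choice domM; exists f => t t' ftt'.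
  by apply/(PM (t, f t) (t', f t')).
have [ranM|/existsNP[u uM]] := pselect (forall u, exists t, M (t, u)).
  right; have [f fM] := choice ranM; exists f => u u' fuu'.
  by apply/(PM (f u, u) (f u', u')).
exfalso; apply: (maxM (M `|` [set (t, u)])).
  split=> [a Ma|]; first by left.
  by move=> /(_ (t, u)) MM; apply: tM; exists u; apply: MM; right.
move=> [a a'] [b b'] [Ma|[-> ->]] [Mb|[-> ->]] //=; first exact: (PM (a, a') (b, b')).
- by split=> e; [case: tM; exists a'; rewrite -e | case: uM; exists a; rewrite -e].
- by split=> e; [case: tM; exists b'; rewrite e | case: uM; exists b; rewrite e].
Qed.

Definition over (T : Type) (Y : set T) (s : seq T) : Prop :=
  forall y, List.In y s -> Y y.

Lemma over_cons T (Y : set T) x s : over Y (x :: s) <-> Y x /\ over Y s.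
Proof.
split=> [o|[Yx o] y [<-//|]]; last exact: o.
by split=> [|y ys]; apply: o; [left|right].
Qed.

Lemma overS T (Y Z : set T) s : Y `<=` Z -> over Y s -> over Z s.
Proof. by move=> YZ o y /o/YZ. Qed.

(** A witness that [Y] has as many finite sequences as elements.  The function is
defined on all sequences so that witnesses for growing sets can be compared
by restriction; two distinct elements are required because they serve as the
letters of a prefix code. *)
Record absorbs (T : Type) (Y : set T) (f : seq T -> T) : Prop := Absorbs {
  absorbs_two : exists a b, [/\ Y a, Y b & a <> b];
  absorbs_fun : forall s, over Y s -> Y (f s);
  absorbs_inj : forall s t, over Y s -> over Y t -> f s = f t -> s = t }.

(** The letters [a] and [b] tell whether an element lies in [Y] or is represented
by its copy [d t] in [Y].  All codes have length two, so concatenating them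
loses no information. *)
Definition pair_code (T : Type) (a b : T) (Y : set T) (d : T -> T) (t : T) : seq T :=
  if pselect (Y t) then [:: a; t] else [:: b; d t].

Lemma flatten_pair_code_over T a b (Y Z : set T) d s :
    Y a -> Y b -> (forall z, Z z -> Y (d z)) -> over (Y `|` Z) s ->
  over Y (flatten (map (pair_code a b Y d) s)).
Proof.
move=> Ya Yb dY; elim: s => [_ y []|x s IH /over_cons[xYZ /IH o]] /=.
rewrite {1}/pair_code; case: pselect => Yx /=; rewrite !over_cons; split=> //; split=> //.
by case: xYZ => // /dY.
Qed.

Lemma flatten_pair_code_inj T a b (Y Z : set T) d s t :
    a <> b -> (forall z z', Z z -> Z z' -> d z = d z' -> z = z') ->
    over (Y `|` Z) s -> over (Y `|` Z) t ->
  flatten (map (pair_code a b Y d) s) = flatten (map (pair_code a b Y d) t) -> s = t.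
Proof.
move=> ab dinj; elim: s t => [[|y t] _ _|x s IH [|y t]] //=.
- by rewrite /pair_code; case: pselect.
- by rewrite /pair_code; case: pselect.
move=> /over_cons[xYZ os] /over_cons[yYZ ot].
rewrite {1 3}/pair_code; case: pselect => Yx; case: pselect => Yy /= [].
- by move=> -> /(IH _ os ot) ->.
- by move=> /ab.
- by move=> /esym/ab.
case: xYZ yYZ => // Zx [//|Zy] /(dinj _ _ Zx Zy) -> /(IH _ os ot) -> //.
Qed.

(** A disjoint copy [g @` Y] of [Y] has room for all the new sequences: a sequence
over the union is coded by one over [Y], sent to [Y] by [f] and moved to the
copy by [g]. *)
Lemma absorbs_extend T (Y : set T) (f : seq T -> T) (g : T -> T) :
    absorbs Y f -> (forall y, Y y -> ~ Y (g y)) ->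
    (forall y y', Y y -> Y y' -> g y = g y' -> y = y') ->
  exists f', absorbs (Y `|` g @` Y) f' /\ (forall s, over Y s -> f' s = f s).
Proof.
move=> [[a [b [Ya Yb ab]]] fY finj] gY ginj.
have /choice[d dP] : forall z, exists y, (g @` Y) z -> Y y /\ g y = z.
  by move=> z; have [[y Yy <-]|nz] := pselect ((g @` Y) z); [exists y|exists z].
pose e := pair_code a b Y d.
have eo s : over (Y `|` g @` Y) s -> over Y (flatten (map e s)).
  by apply: flatten_pair_code_over => // z /dP[].
exists (fun s => if pselect (over Y s) then f s else g (f (flatten (map e s)))).
split; last by move=> s; case: pselect.
split.
- by exists a, b; split=> //; left.
- move=> s /eo os; case: pselect => oY; first by left; exact: fY.
  by right; exists (f (flatten (map e s))) => //; exact: fY.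
- move=> s t os ot; case: pselect => oYs; case: pselect => oYt /=.
  + exact: finj.
  + move=> fg; exfalso; apply: (gY (f (flatten (map e t)))); first exact/fY/eo.
    by rewrite -fg; exact: fY.
  + move=> fg; exfalso; apply: (gY (f (flatten (map e s)))); first exact/fY/eo.
    by rewrite fg; exact: fY.
  + move=> /ginj fg; have {fg}: f (flatten (map e s)) = f (flatten (map e t)).
      by apply: fg; apply/fY/eo.
    move=> /finj fg; have : flatten (map e s) = flatten (map e t) by apply: fg; exact: eo.
    apply: (@flatten_pair_code_inj _ _ _ _ (g @` Y)) => //.
    by move=> z z' /dP[_ {2}<-] /dP[_ {2}<-] ->.
Qed.

(** A finite sequence over the union of a chain is already a sequence over one of
its members. *)
Lemma absorbs_chain T (F : set (set T * (seq T -> T))) p0 :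
    F p0 -> (forall p, F p -> absorbs p.1 p.2) ->
    (forall p q, F p -> F q ->
       (p.1 `<=` q.1 /\ forall s, over p.1 s -> q.2 s = p.2 s) \/
       (q.1 `<=` p.1 /\ forall s, over q.1 s -> p.2 s = q.2 s)) ->
  exists f, absorbs (\bigcup_(p in F) p.1) f /\
            forall p s, F p -> over p.1 s -> f s = p.2 s.
Proof.
move=> Fp0 Fabs tot; set Y := \bigcup_(p in F) p.1.
have sub p : F p -> p.1 `<=` Y by move=> Fp y py; exists p.
have ov1 s : over Y s -> exists2 p, F p & over p.1 s.
  elim: s => [_|x s IH /over_cons[[q Fq qx] /IH[p Fp ps]]]; first by exists p0.
  have [[pq _]|[qp _]] := tot p q Fp Fq.
    by exists q => //; apply/over_cons; split=> //; exact: overS ps.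
  by exists p => //; apply/over_cons; split=> //; exact: qp.
have ov2 s t : over Y s -> over Y t -> exists p, [/\ F p, over p.1 s & over p.1 t].
  move=> /ov1[p Fp ps] /ov1[q Fq qt]; have [[pq _]|[qp _]] := tot p q Fp Fq.
    by exists q; split=> //; exact: overS ps.
  by exists p; split=> //; exact: overS qt.
have /choice[f fP] : forall s, exists y, forall p, F p -> over p.1 s -> y = p.2 s.
  move=> s; have [/ov1[p Fp ps]|nos] := pselect (over Y s); last first.
    by exists (p0.2 s) => p /sub pY ps; case: nos; exact: overS ps.
  exists (p.2 s) => q Fq qs; have [[_ pq]|[_ qp]] := tot p q Fp Fq.
    by rewrite pq.
  by rewrite qp.
exists f; split; last by move=> p s Fp; exact: fP.
split.
- have [a [b [pa pb ab]]] := absorbs_two (Fabs _ Fp0).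
  by exists a, b; split=> //; apply: (sub p0).
- move=> s /ov1[p Fp ps]; rewrite (fP _ p)//; apply: (sub p) => //.
  exact: (absorbs_fun (Fabs _ Fp)).
- move=> s t os ot; have [p [Fp ps pt]] := ov2 _ _ os ot.
  by rewrite !(fP _ p)//; apply: (absorbs_inj (Fabs _ Fp)).
Qed.

Lemma absorbs_nat T : embeds nat T -> exists p : set T * (seq T -> T), absorbs p.1 p.2.
Proof.
move=> [h hinj].
have /choice[d dP] : forall t, exists n, range h t -> h n = t.
  by move=> t; have [[n _ <-]|nt] := pselect (range h t); [exists n|exists 0].
exists (range h, fun s => h (pickle (map d s))); split=> /=.
- by exists (h 0), (h 1); split; [exists 0|exists 1|move/hinj].
- by move=> s _; exists (pickle (map d s)).
move=> s t + + /hinj/(pcan_inj pickleK).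
elim: s t => [|x s IH] [|y t] //= /over_cons[xh hs] /over_cons[yh ht] [dxy /(IH _ hs ht) ->].
by rewrite -(dP _ xh) -(dP _ yh) dxy.
Qed.

Lemma embeds_sig T (A B : set T) : embeds {t | A t} {t | B t} ->
  exists h : T -> T, (forall t, A t -> B (h t)) /\
    forall t t', A t -> A t' -> h t = h t' -> t = t'.
Proof.
move=> [f finj]; exists (fun t => if pselect (A t) is left At then sval (f (exist _ t At)) else t).
split=> [t At|t t' At At']; first by case: pselect => // At'; exact: svalP.
case: pselect => // {}At; case: pselect => // {}At'.
move=> ff; have /finj[] // : f (exist _ t At) = f (exist _ t' At').
by move: ff; case: (f _) => u Bu; case: (f _) => v Bv /= uv; exact: eq_exist.
Qed.

(** A maximal [Y] with as many finite sequences as elements has a complement that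
embeds into [Y]: otherwise [Y] would embed into its complement and could be
enlarged by [absorbs_extend].  So every sequence over [T] is coded by one
over [Y]. *)
Lemma embeds_seq T : embeds nat T -> embeds (seq T) T.
Proof.
move=> /absorbs_nat[p0 abs0].
pose S := {p : set T * (seq T -> T) | absorbs p.1 p.2}.
pose R (p q : S) := `[< (sval p).1 `<=` (sval q).1 /\
   forall s, over (sval p).1 s -> (sval q).2 s = (sval p).2 s >].
have [||A totA|[[Y f] /= abs] maxY] := @ZL_preorder S (exist _ p0 abs0) R.
- by move=> p; apply/asboolP; split.
- move=> q p r /asboolP[pq fpq] /asboolP[qr fqr]; apply/asboolP.
  split=> [|s ps]; first exact: subset_trans qr.
  by rewrite fqr ?fpq//; exact: overS ps.
- have [[q Aq]|A0] := pselect (A !=set0); last first.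
    by exists (exist _ p0 abs0) => q Aq; case: A0; exists q.
  have [|||f [absf fE]] := @absorbs_chain T [set sval p | p in A] (sval q).
  + by exists q.
  + by move=> _ [p Ap <-]; exact: (svalP p).
  + move=> _ _ [p Ap <-] [r Ar <-].
    by have [/asboolP|/asboolP] := totA p r Ap Ar; [left|right].
  exists (exist _ (_, f) absf) => p Ap; apply/asboolP; split=> /=.
    by move=> y py; exists (sval p) => //; exists p.
  by move=> s ps; apply: fE => //; exists p.
have [a [b [Ya Yb ab]]] := absorbs_two abs.
have [/embeds_sig[h [hY hinj]]|/embeds_sig[g [gY ginj]]] :=
    embeds_total {t | (~` Y) t} {t | Y t}.
  have oT s : over (Y `|` ~` Y) s by move=> t _; rewrite setUv.
  have hinj' : forall z z', (~` Y) z -> (~` Y) z' -> h z = h z' -> z = z' by [].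
  have o s : over Y (flatten (map (pair_code a b Y h) s)).
    exact: (@flatten_pair_code_over _ _ _ _ (~` Y)).
  exists (fun s => f (flatten (map (pair_code a b Y h) s))) => s t.
  move=> /(absorbs_inj abs) st.
  by apply: (flatten_pair_code_inj ab hinj' (oT s) (oT t)); exact: st.
have [f' [abs' f'E]] := absorbs_extend abs gY ginj.
have : R (exist _ (_, f') abs') (exist _ (Y, f) abs).
  by apply: maxY; apply/asboolP; split=> //= y Yy; left.
by move=> /asboolP[/= YY _]; exfalso; apply: (gY a) => //; apply: YY; right; exists a.
Qed.

(** * Types that do not embed the continuum *)

Definition small (T : Type) : Prop := ~ embeds (nat -> bool) T.

Lemma small_embeds T U : embeds T U -> small U -> small T.
Proof. by move=> TU sU cT; apply: sU; exact: embeds_trans TU. Qed.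

(** Cantor's diagonal argument. *)
Lemma small_nat : small nat.
Proof.
move=> [g ginj]; pose d n := `[< exists b, g b = n /\ b n = false >].
have [dt|df] := boolP (d (g d)).
  by move: (dt) => /asboolP[b [/ginj -> ]]; rewrite dt.
by move/asboolP: (df); apply; exists d; split=> //; exact: negbTE.
Qed.

(** The summand [nat] makes the alphabet infinite, so that [embeds_seq] applies
even when [T] is finite, and it lets a sequence carry natural numbers as
additional data. *)
Lemma small_seq_sum_nat T : small T -> small (seq (T + nat)).
Proof.
move=> sT.
suff sTn : small (T + nat).
  apply: small_embeds sTn; apply: embeds_seq; exists inr; by move=> ? ? [].
have [Tnat|natT] := embeds_total T nat.
  apply: small_embeds small_nat; have [f finj] := Tnat.
  exists (fun x : T + nat => pickle (match x with inl t => inl (f t) | inr n => inr n end : nat + nat)%type).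
  move=> [t|n] [t'|n'] /(pcan_inj pickleK) // []; last by move->.
  by move=> /finj->.
apply: small_embeds sT; apply: embeds_trans (embeds_seq natT).
have [h hinj] := natT.
exists (fun x : T + nat => match x with inl t => [:: t] | inr n => [:: h n; h n] end).
by move=> [t|n] [t'|n'] // []; [move=> -> | move=> /hinj -> ].
Qed.


(** * Martin's axiom for strict orders *)

Lemma card_le_embeds T U : card_le [set: T] [set: U] <-> embeds T U.
Proof.
split=> [/card_leP[f]|[f finj]].
  exists (fun t => val (f (SigSub (mem_set (I : [set: T] t))))).
  move=> t t' /val_inj ff; pose i (u : T) := SigSub (mem_set (I : [set: T] u)).
  exact: (congr1 val (@inj _ _ _ f (i t) (i t') (in_setT _) (in_setT _) ff)).
have [g] : $|{injfun [set: T] >-> [set: U]}|.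
  by apply/injfunPex; exists f => // t t' _ _ /finj.
exact: inj_card_le g.
Qed.

Section StrictPoset.
Variables (P : Type) (lt : P -> P -> Prop).
Hypotheses (lt_irr : forall p, ~ lt p p).
Hypotheses (lt_trans : forall p q r, lt p q -> lt q r -> lt p r).

(** The proofs are parameters of the type so that its order structure is
determined by the type alone. *)
Definition strict_poset (irr : forall p, ~ lt p p)
  (tr : forall p q r, lt p q -> lt q r -> lt p r) : Type := P.
Local Notation Q := (strict_poset lt_irr lt_trans).

HB.instance Definition _ := gen_eqMixin Q.
HB.instance Definition _ := gen_choiceMixin Q.

Definition strict_le (p q : Q) : bool := `[< p = q \/ lt p q >].

Lemma strict_le_refl : reflexive strict_le.
Proof. by move=> p; apply/asboolP; left. Qed.

Lemma strict_le_anti : antisymmetric strict_le.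
Proof.
move=> p q /andP[/asboolP[//|pq] /asboolP[//|qp]].
by case: (lt_irr (lt_trans pq qp)).
Qed.

Lemma strict_le_trans : transitive strict_le.
Proof.
move=> q p r /asboolP[->//|pq] /asboolP[<-|qr]; apply/asboolP; right=> //.
exact: lt_trans qr.
Qed.

HB.instance Definition _ := Order.Le_isPOrder.Build (Order.Disp tt tt) Q
  strict_le_refl strict_le_anti strict_le_trans.

End StrictPoset.

(** Martin's axiom in the form used below: the fibres of a map to the natural
numbers are the linked sets, and the dense sets are indexed by a small type. *)
Lemma MA_strict_order (P : Type) (lt : P -> P -> Prop) (K : Type) (E : K -> set P)
    (condition_code : P -> nat) (p0 : P) :
    MA_sigma_linked ->
    (forall p, ~ lt p p) -> (forall p q r, lt p q -> lt q r -> lt p r) ->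
    (forall p q, condition_code p = condition_code q -> exists2 r, lt r p & lt r q) ->
    small K -> (forall k p, exists2 q, E k q & lt q p) ->
  exists G : set P,
    (forall p q, G p -> G q ->
      exists2 r, G r & (r = p \/ lt r p) /\ (r = q \/ lt r q)) /\
    forall k, exists2 p, G p & E k p.
Proof.
move=> MA irr tr lnk sK dE.
pose Q := strict_poset irr tr : porderType _.
have ltle (p q : Q) : lt p q -> (p <= q)%O by move=> pq; apply/asboolP; right.
have [||||G [_ _ Gdir] GE] := MA _ Q _ _ (range (E : K -> set Q)).
- by exists p0.
- exists (fun n => [set p | condition_code p = n]).
    by move=> n p q /= pn qn; have [r rp rq] := lnk p q (etrans pn (esym qn)); exists r; split; exact: ltle.
  by apply/seteqP; split=> // p _; exists (condition_code p).
- split.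
    apply: card_le_trans (card_image_le _ _) _; apply/card_le_embeds.
    by have [|/sK] := embeds_total K (nat -> bool).
  move=> le; apply: sK; apply/card_le_embeds.
  exact: card_le_trans le (card_image_le _ _).
- by move=> _ [k _ <-] p; have [q Eq qp] := dE k p; exists q => //; exact: ltle.
exists G; split=> [p q Gp Gq|k].
  by have [r Gr [/asboolP rp /asboolP rq]] := Gdir _ _ Gp Gq; exists r.
by have [p [Gp Ep]] := GE (E k) (ex_intro2 _ _ k I erefl); exists p.
Qed.


(** * Forcing a set with few colours *)

Definition meet (J : eqType) (X : J -> set nat) (s : seq J) : set nat :=
  [set k | forall j, j \in s -> X j k].

Definition laver_for (c : nat -> nat -> nat) (x : set nat) : Prop :=
  forall n, exists L : seq nat, (size L <= n.+1)%N /\ forall k, x k -> c n k \in L.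

Section LaverForcing.
Variables (J : eqType) (X : J -> set nat) (c : nat -> nat -> nat) (g0 : nat -> nat).
Hypothesis cb : bounded_colouring c.
Hypothesis g0P : forall s m, fat (meet X s `&` [set k | agree m (c^~ k) g0]).

(** A promise [(p, i, g)] puts the point [p] into the generic set, as a limit of
points of [meet X i] whose colours follow the branch [g]. *)
Definition promise : Type := (nat * seq J * (nat -> nat))%type.

Definition honest (e : promise) : Prop :=
  meet X e.1.2 e.1.1 /\
  forall m l, fat (meet X e.1.2 `&` [set q | near_upto l q e.1.1]
                   `&` [set k | agree m (c^~ k) e.2]).

(** The colour sequences a new point may start with: the branch [g0], which is
compatible with all the sets, the promised branches, and the actual colours
of the points. *)
Definition traces (s : seq promise) : seq (nat -> nat) :=
  g0 :: map snd s ++ map (fun e => c^~ e.1.1) s.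

Definition refines (m : nat) (s' s : seq promise) : Prop :=
  forall h', h' \in traces s' -> exists2 h, h \in traces s & agree m h' h.

Definition few_colours (s : seq promise) : Prop :=
  forall n, exists L : seq nat, (size L <= n.+1)%N /\ forall h, h \in traces s -> h n \in L.

(** The level is at least four times the number of promises because the union of
two linked conditions with [k] promises each has [4 * k + 1] traces, and
[m + 1] colours are allowed at level [m]. *)
Definition condition_pred (p : seq promise * nat) : Prop :=
  [/\ forall e, e \in p.1 -> honest e, (4 * size p.1 <= p.2)%N & few_colours p.1].

Definition condition : Type := {p | condition_pred p}.

(** The level grows strictly, which makes the relation irreflexive and spares a
separate argument for antisymmetry.  Points may be added only along the
traces of the weaker condition, up to its level. *)
Definition stronger (p q : condition) : Prop :=
  [/\ ((sval q).2 < (sval p).2)%N, {subset (sval q).1 <= (sval p).1} &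
      refines (sval q).2 (sval p).1 (sval q).1].

Lemma size_traces s : size (traces s) = (2 * size s).+1.
Proof. by rewrite /= size_cat !size_map addnn mul2n. Qed.

Lemma trace_base s : g0 \in traces s.
Proof. by rewrite inE eqxx. Qed.

Lemma trace_branch s e : e \in s -> e.2 \in traces s.
Proof. by move=> es; rewrite inE mem_cat (map_f snd es) orbT. Qed.

Lemma trace_point s e : e \in s -> c^~ e.1.1 \in traces s.
Proof.
by move=> es; rewrite inE mem_cat; apply/or3P/Or33/(map_f (fun e => c^~ e.1.1) es).
Qed.

Lemma traces_cat s t h : (h \in traces (s ++ t)) = (h \in traces s) || (h \in traces t).
Proof.
rewrite !inE !map_cat !mem_cat.
by do 5![case: (_ \in _) || case: (_ == _)].
Qed.

Lemma refines_trans m s1 s2 s3 : refines m s1 s2 -> refines m s2 s3 -> refines m s1 s3.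
Proof.
move=> s12 s23 h1 /s12[h2 /s23[h3 h3s a23] a12]; exists h3 => //.
exact: agree_trans a23.
Qed.

Lemma refines_le m m' s s' : (m <= m')%N -> refines m' s s' -> refines m s s'.
Proof.
by move=> mm' ss' h /ss'[h' h's a]; exists h' => //; exact: agree_le a.
Qed.

Lemma refinesxx m s : refines m s s.
Proof. by move=> h hs; exists h. Qed.

(** Below [m] there are no new colours; from [m] on, the traces are too few to
show too many colours. *)
Lemma few_colours_refines m s s' :
  few_colours s -> refines m s' s -> (2 * size s' <= m)%N -> few_colours s'.
Proof.
move=> fs s's sm n; have [nm|mn] := ltnP n m.
  have [L [sL hL]] := fs n; exists L; split=> // h' /s's[h hs a].
  by rewrite a// hL.
exists (map (fun h => h n) (traces s')); split.
  by rewrite size_map size_traces ltnS; apply: leq_trans mn.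
by move=> h hs; apply/mapP; exists h.
Qed.

Lemma stronger_irr p : ~ stronger p p.
Proof. by move=> [/[!ltnn]]. Qed.

Lemma stronger_trans p q r : stronger p q -> stronger q r -> stronger p r.
Proof.
move=> [qp sqp rpq] [rq srq rqr]; split.
- exact: ltn_trans qp.
- by move=> e /srq/sqp.
- by apply: refines_trans rqr; apply: refines_le rpq; exact: ltnW.
Qed.

Lemma condition0 : condition_pred ([::], 0).
Proof.
split=> // n; exists [:: g0 n]; split=> // h.
by rewrite inE => /eqP->; rewrite inE.
Qed.

(** The points, the level and the branches up to the level; the index [i] of a
promise ranges over an uncountable type and is left out. *)
Definition condition_code (p : condition) : nat :=
  pickle ((sval p).2, [seq (e.1.1, mkseq e.2 (sval p).2) | e <- (sval p).1]).

Lemma refines_same_code m s s' :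
  [seq (e.1.1, mkseq e.2 m) | e <- s] = [seq (e.1.1, mkseq e.2 m) | e <- s'] ->
  refines m (s ++ s') s.
Proof.
move=> ss' h; rewrite traces_cat => /orP[hs|]; first by exists h.
rewrite inE mem_cat => /or3P[/eqP->|/mapP[e es' ->]|/mapP[e es' ->]].
- by exists g0 => //; exact: trace_base.
- have : (e.1.1, mkseq e.2 m) \in [seq (e.1.1, mkseq e.2 m) | e <- s].
    by rewrite ss'; apply: map_f.
  move=> /mapP[e' e's [_ ee']]; exists e'.2; first exact: trace_branch.
  by move=> n nm; have := congr1 (nth 0 ^~ n) ee'; rewrite !nth_mkseq.
- have : (e.1.1, mkseq e.2 m) \in [seq (e.1.1, mkseq e.2 m) | e <- s].
    by rewrite ss'; apply: map_f.
  move=> /mapP[e' e's [-> _]]; exists (c^~ e'.1.1) => //.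
  exact: trace_point.
Qed.

Lemma condition_code_linked p q : condition_code p = condition_code q ->
  exists2 r, stronger r p & stronger r q.
Proof.
move=> /(pcan_inj pickleK); case: p => -[s m] [/= hs ms fs].
case: q => -[s' m'] [/= hs' ms' fs'] [mm']; move: mm' ms' => <- {m'} ms' ss'.
have szs : size s = size s'.
  by have := congr1 size ss'; rewrite !size_map.
have R : refines m (s ++ s') s by exact: refines_same_code.
have R' : refines m (s ++ s') s'.
  move=> h; rewrite traces_cat orbC -traces_cat => hs's.
  by apply: (refines_same_code (esym ss')).
have cr : condition_pred (s ++ s', m.+1 + 4 * size (s ++ s'))%N.
  split=> /=.
  - by move=> e; rewrite mem_cat => /orP[/hs|/hs'].
  - by rewrite leq_addl.
  - by apply: (few_colours_refines fs R); rewrite size_cat; lia.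
exists (exist _ _ cr); split=> //=; try lia; move=> e es.
- by rewrite mem_cat es.
- by rewrite mem_cat es orbT.
Qed.

(** The new point lies in a crowded part of the sets following the trace [h], so
[fat_branch] applied to its neighbourhoods there gives a branch for it.  That
branch agrees with [h] up to the new level, so no colours are added below it. *)
Lemma extend_condition (p : condition) (i : seq J) (O : set nat) (h : nat -> nat) (l : nat) :
    h \in traces (sval p).1 ->
    (forall m, fat (meet X i `&` O `&` [set k | agree m (c^~ k) h])) ->
  exists q, [/\ stronger q p, (l < (sval q).2)%N &
    exists2 e, e \in (sval q).1 & e.1.2 = i /\ O e.1.1].
Proof.
(* The new level leaves room for one more promise and is beyond [l]. *)
case: p => -[s m] [/= hs ms fs] hts fO; pose M := (m + l + 4 * (size s).+1)%N.
have [C cC [[x Cx] CO]] := fO M.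
have [[iX Ox] xh] := CO x Cx.
have [||||g gP] := @fat_branch [set C `&` [set q | near_upto k q x] | k in setT] c.
- by exists (C `&` [set q | near_upto 0 q x]); exists 0.
- by move=> _ [k _ <-]; exact: crowded_fat_near.
- move=> _ _ [k _ <-] [k' _ <-].
  exists (C `&` [set q | near_upto (maxn k k') q x]); first by exists (maxn k k').
  by move=> q [Cq /= near]; split; split=> //=; apply: near_upto_le near; rewrite ?leq_maxl ?leq_maxr.
- exact: cb.
have gh : agree M g h.
  have /fat_nonempty[k [[Ck _] /= kg]] := gP _ M (ex_intro2 _ _ 0 I erefl).
  by have [_ /= kh] := CO k Ck; apply: agree_trans kh; exact: agree_sym.
pose e : promise := (x, i, g).
have R : refines M (e :: s) s.
  move=> h'; rewrite -cat1s traces_cat => /orP[|h's]; last by exists h'.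
  rewrite /= !inE => /or3P[/eqP->|/eqP->|/eqP->].
  - by exists g0 => //; exact: trace_base.
  - by exists h.
  - by exists h.
have cq : condition_pred (e :: s, M.+1).
  split=> /=; last by apply: (few_colours_refines fs R); rewrite /= /M; lia.
    move=> e'; rewrite inE => /predU1P[->|/hs//]; split=> //= m' l'.
    apply: fatS (gP _ m' (ex_intro2 _ _ l' I erefl)) => k [[Ck kx] kg]; split=> //.
    by split=> //; have [[]] := CO k Ck.
  by rewrite /M; lia.
exists (exist _ _ cq); split=> /=.
- split=> /=; first by rewrite /M; lia.
    by move=> e' es; rewrite inE es orbT.
  by apply: refines_le R; rewrite /M; lia.
- by rewrite /M; lia.
- by exists e; rewrite ?inE ?eqxx.
Qed.

Definition visits (p : condition) (x : nat) (i : seq J) : Prop :=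
  exists2 e, e \in (sval p).1 & e.1 = (x, i).

Lemma stronger_visits p q x i : stronger p q -> visits q x i -> visits p x i.
Proof. by move=> [_ qp _] [e /qp ep ei]; exists e. Qed.

(** Meeting this set puts a point into [meet X i] and, if [x] is promised for [i],
places another such point near [x].  The promise may appear only in stronger
conditions, hence the quantification over [r]. *)
Definition task (k : seq J * nat * nat) : set condition :=
  let: (i, x, l) := k in
  [set p | [/\ (l < (sval p).2)%N, exists y, visits p y i &
     (exists2 r, r = p \/ stronger r p & visits r x i) ->
     exists y, [/\ y <> x, near_upto l y x & visits p y i]]].

Lemma task_dense k p : exists2 q, task k q & stronger q p.
Proof.
case: k => [[i x] l].
have [|m|p1 [p1p lp1 [[[y i1] g] /= ep1 [ei1 _]]]] := @extend_condition p i setT g0 l.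
- exact: trace_base.
- by rewrite setIT; exact: g0P.
move: ei1 ep1 => -> {i1} ep1.
have v1 : visits p1 y i by exists (y, i, g).
(* If some stronger condition promises [x] for [i], its branch at [x] is the
   trace along which the nearby point is added. *)
have [[r rp1 [e er ei]]|nr] := pselect (exists2 r, r = p1 \/ stronger r p1 & visits r x i);
  last by exists p1 => //; split=> //; exists y.
have rp : stronger r p by case: rp1 => [->//|rp1]; exact: stronger_trans p1p.
have [_ he] : honest e by case: r er {rp1 rp} => -[s m] [/= hs _ _] /hs.
move: he; rewrite ei /= => he.
have [||q [qr lq [[[z i2] g'] /= qz [ei2 [zx zl]]]]] :=
    @extend_condition r i [set z | z <> x /\ near_upto l z x] e.2 l.
- exact: trace_branch.
(* Deleting the point [x] from a fat set leaves a fat set. *)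
- move=> m; have : fat ([set x] `|` (meet X i `&` [set z | z <> x /\ near_upto l z x] `&`
      [set k | agree m (c^~ k) e.2])).
    apply: fatS (he m l) => z [[zi zl] ze].
    by have [->|zx] := pselect (z = x); [left|right].
  by move=> /fatU[/fat1N|].
exists q; last exact: stronger_trans rp.
have vq : visits q z i by exists (z, i2, g') => //=; rewrite ei2.
by split=> //; [exists z | move=> _; exists z].
Qed.

End LaverForcing.

(** In the generic set, the points promised for a fixed [s] form a crowded subset
of [meet X s].  Once the generic filter contains a condition of level above
[n], all points take one of its at most [n + 1] colours under [c n]. *)
Lemma laver_extension (J : eqType) (X : J -> set nat) (c : nat -> nat -> nat) :
    MA_sigma_linked -> small J -> bounded_colouring c ->
    (forall s, fat (meet X s)) ->
  exists x : set nat, (forall s, fat (x `&` meet X s)) /\ laver_for c x.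
Proof.
move=> MA sJ cb fX.
have [||||g0 g0P'] := @fat_branch (range (meet X)) c.
- by exists (meet X [::]); exists [::].
- by move=> _ [s _ <-].
- move=> _ _ [s _ <-] [t _ <-]; exists (meet X (s ++ t)); first by exists (s ++ t).
  by move=> k kst; split=> j js; apply: kst; rewrite mem_cat js ?orbT.
- exact: cb.
have g0P s m : fat (meet X s `&` [set k | agree m (c^~ k) g0]).
  by apply: g0P'; exists s.
have sK : small (seq J * nat * nat).
  (* The two numbers go in front of the sequence [s]. *)
  apply: small_embeds (small_seq_sum_nat sJ).
  exists (fun k => inr k.1.2 :: inr k.2 :: map inl k.1.1 : seq (J + nat)).
  move=> [[s x] l] [[s' x'] l'] /= [-> -> ] /(inj_map _) -> //.
  by move=> ? ? [].
have [G [Gdir Gtask]] := MA_strict_order (exist _ _ (condition0 X c g0)) MA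
  (@stronger_irr J X c g0) (@stronger_trans J X c g0) (@condition_code_linked J X c g0) sK
  (task_dense cb g0P).
pose x := [set y | exists2 p, G p & exists i, visits p y i].
exists x; split=> [s|n].
  pose C := [set y | exists2 p, G p & visits p y s].
  exists C.
    move=> y l [p Gp py]; have [q Gq [lq _ qtask]] := Gtask (s, y, l).
    have [r Gr [rp rq]] := Gdir _ _ Gp Gq.
    have ry : visits r y s by case: rp => [->//|rp]; exact: stronger_visits py.
    have [z [zy zl zq]] := qtask (ex_intro2 _ _ r rq ry).
    by exists z => //; split=> //; exists q.
  split; first by have [p Gp [_ [y py] _]] := Gtask (s, 0, 0); exists y, p.
  move=> y [p Gp py]; split; first by exists p => //; exists s.
  case: py => -[[y' s'] g] ep [ey es]; move: ep; rewrite {}ey {}es => ep.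
  by case: p ep {Gp} => -[t m] [/= ht _ _] /ht[].
have [p Gp [np _ _]] := Gtask ([::], 0, n).
have [L [sL hL]] : exists L : seq nat, (size L <= n.+1)%N /\
    forall h, h \in traces c g0 (sval p).1 -> h n \in L.
  by case: p {Gp np} => -[t m] [/= _ _ ft]; exact: ft.
exists L; split=> // y [q Gq [i [e eq ei]]].
have [r Gr [rp rq]] := Gdir _ _ Gp Gq.
have er : e \in (sval r).1 by case: rq => [->//|[_ qr _]]; exact: qr.
have R : refines c g0 (sval p).2 (sval r).1 (sval p).1.
  by case: rp => [->|[_ _]//]; exact: refinesxx.
have [|h hp a] := R (c^~ y); first by have := trace_point c g0 er; rewrite ei.
by rewrite (a n np) hL.
Qed.


(** * A tower of length continuum *)

Lemma exists_strict_well_order (T : eqType) : exists lt : rel T,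
  [/\ well_founded lt, transitive lt & forall a b, [\/ lt a b, a = b | lt b a]].
Proof.
have [R wo] := well_ordering_principle T.
have min (A : pred T) a : a \in A -> exists2 z, z \in A & forall x, x \in A -> R z x.
  by move=> Aa; have [|z [[Az zmin] _]] := wo A; [exists a|exists z].
have Rxx a : R a a.
  have [|z] := min (pred1 a) a; first by rewrite inE.
  by rewrite inE => /eqP-> /(_ a); apply; rewrite inE.
have Rtot a b : R a b \/ R b a.
  have [|z] := min (pred2 a b) a; first by rewrite !inE eqxx.
  by rewrite inE => /orP[/eqP->|/eqP->] zm; [left|right]; apply: zm; rewrite !inE eqxx ?orbT.
have Ranti a b : R a b -> R b a -> a = b.
  move=> ab ba; have [|z [_ zu]] := wo (pred2 a b); first by exists a; rewrite !inE eqxx.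
  rewrite -[LHS](zu a) -?[RHS](zu b)//; split=> [|x]; rewrite !inE ?eqxx ?orbT//;
    by move=> /orP[/eqP->|/eqP->].
have Rtr a b c : R a b -> R b c -> R a c.
  move=> ab bc; have [|z] := min [pred x | [|| x == a, x == b | x == c]] a.
    by rewrite !inE eqxx.
  rewrite !inE => /or3P[/eqP->|/eqP->|/eqP->] zm.
  - by apply: zm; rewrite !inE eqxx !orbT.
  - have ba : R b a by apply: zm; rewrite !inE eqxx.
    by rewrite (Ranti a b).
  - have cb : R c b by apply: zm; rewrite !inE eqxx !orbT.
    by rewrite -(Ranti b c).
exists (fun a b => R a b && (a != b)); split.
- apply: contrapT => nwf.
  have /existsNP[a0 na0] : ~ forall a, Acc (fun a b => R a b && (a != b)) a by [].
  have [|z /asboolP nz zm] := min [pred a | `[< ~ Acc (fun a b => R a b && (a != b)) a >]] a0.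
    exact/asboolP.
  apply: nz; constructor => y /andP[yz yNz]; apply: contrapT => ny.
  have zy : R z y by apply: zm; exact/asboolP.
  by move: yNz; rewrite (Ranti y z)// eqxx.
- move=> b a c /andP[ab aNb] /andP[bc bNc]; rewrite (Rtr _ _ _ ab bc)/=.
  by apply/eqP => ac; move: bNc; rewrite (Ranti b c)// ?eqxx// -ac.
- move=> a b; have [->|ab] := eqVneq a b; first by constructor 2.
  by have [Rab|Rba] := Rtot a b; [constructor 1|constructor 3]; rewrite ?Rab ?Rba//= eq_sym.
Qed.

(** Recursion with a choice at each stage that depends on the earlier choices. *)
Lemma wf_selection (W V : Type) (lt : rel W) (v0 : V)
    (good : forall a, ({b | lt b a} -> V) -> V -> Prop) : well_founded lt ->
  exists x : W -> V, forall a, (exists v, good a (x \o sval) v) -> good a (x \o sval) (x a).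
Proof.
move=> wf.
have /choice[pick pickP] : forall p : {a : W & {b | lt b a} -> V},
    exists v, (exists v', good (projT1 p) (projT2 p) v') -> good (projT1 p) (projT2 p) v.
  move=> p; have [[v gv]|ng] := pselect (exists v', good (projT1 p) (projT2 p) v').
    by exists v.
  by exists v0.
pose step a (f : forall b, lt b a -> V) : V :=
  pick (existT (fun a => {b | lt b a} -> V) a (fun b => f (sval b) (svalP b))).
exists (Fix wf _ step) => a /(pickP (existT (fun a => {b | lt b a} -> V) a _)).
rewrite Fix_eq// => {}a f g fg; congr step.
by apply: functional_extensionality_dep => b; apply: functional_extensionality_dep => ba.
Qed.

(** If some element has a large initial segment, a least such element has a large
initial segment all of whose elements have small ones. *)
Lemma embeds_small_segments (T : eqType) (lt : rel T) : well_founded lt ->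
  embeds (nat -> bool) T ->
  embeds (nat -> bool) {a | `[< small {b | lt b a} >]}.
Proof.
move=> wf cT; have [sm|/existsNP[a0 na0]] := pselect (forall a, small {b | lt b a}).
  apply: embeds_trans cT _.
  by exists (fun a => exist _ a (asboolT (sm a))) => a a' [].
elim/(well_founded_ind wf): a0 na0 => a IH /contrapT na.
have [[b [ba nb]]|sm] := pselect (exists b, lt b a /\ ~ small {b' | lt b' b}).
  exact: IH ba nb.
apply: embeds_trans na _.
have smb (b : {b | lt b a}) : small {b' | lt b' (sval b)}.
  by apply: contrapT => nb; apply: sm; exists (sval b); split=> //; exact: (svalP b).
exists (fun b => exist _ (sval b) (asboolT (smb b))).
by move=> b b' [] bb'; exact: val_inj.
Qed.

Lemma embeds_colourings : embeds (nat -> nat -> nat) (nat -> bool).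
Proof.
exists (fun c i => `[< exists n k, i = pickle (n, k, c n k) >]).
move=> c c' cc'; apply/funext => n; apply/funext => k.
have := congr1 (fun f : nat -> bool => f (pickle (n, k, c n k))) cc'.
rewrite /= (_ : `[< _ >] = true); last by apply/asboolP; exists n, k.
by move=> /esym/asboolP[n' [k' /(pcan_inj pickleK)[-> -> ->]]].
Qed.

Lemma max_of_seq (T : eqType) (lt : rel T) (s : seq T) :
    transitive lt -> (forall a b, [\/ lt a b, a = b | lt b a]) -> s != [::] ->
  exists2 b, b \in s & forall a, a \in s -> a = b \/ lt a b.
Proof.
move=> tr tot; elim: s => // x s IH _; have [->|/IH[b bs bm]] := eqVneq s [::].
  by exists x => [|a]; rewrite inE // => /eqP; left.
have [xb|xb|bx] := tot x b.
- exists b => [|a]; rewrite inE ?bs ?orbT//.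
  by move=> /predU1P[->|/bm//]; right.
- exists b => [|a]; rewrite inE ?bs ?orbT//.
  by move=> /predU1P[->|/bm//]; left.
- exists x => [|a]; rewrite inE ?eqxx// => /predU1P[->|/bm]; first by left.
  by move=> [->|ab]; right => //; exact: tr bx.
Qed.

(** The stages are the elements with small initial segments.  There are continuum
many of them, so each can be assigned a sequence of colourings in such a way
that all sequences of colourings occur. *)
Lemma laver_tower : MA_sigma_linked ->
  exists (S : eqType) (x : S -> set nat),
    (forall s, fat (meet x s)) /\
    forall c, bounded_colouring c -> exists a, laver_for c (x a).
Proof.
move=> MA; pose W : eqType := (nat -> bool)%type.
have [lt [wf tr tot]] := exists_strict_well_order W.
have cS : embeds (nat -> bool) {a : W | `[< small {b | lt b a} >]}.
  by apply: embeds_small_segments wf _; exists id.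
have [f finj] := embeds_trans embeds_colourings cS.
(* The assignment [e] of sequences of colourings to stages inverts the
   embedding [f]. *)
have /choice[e eP] : forall a, exists c, forall c', sval (f c') = a -> c' = c.
  move=> a; have [[c ca]|nc] := pselect (exists c, sval (f c) = a).
    by exists c => c' c'a; apply: finj; apply: val_inj; rewrite /= c'a ca.
  by exists (fun _ _ => 0) => c' c'a; case: nc; exists c'.
pose good a (X : {b | lt b a} -> set nat) x :=
  (forall s, fat (x `&` meet X s)) /\ (bounded_colouring (e a) -> laver_for (e a) x).
have [x xP] := wf_selection setT good wf.
have goodx a : small {b | lt b a} -> (forall s : seq {b | lt b a}, fat (meet (x \o sval) s)) ->
    good a (x \o sval) (x a).
  move=> sa fa; apply: xP; have [eb|neb] := pselect (bounded_colouring (e a)).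
    by have [y [fy ey]] := laver_extension MA sa eb fa; exists y.
  by exists setT; split=> // s; rewrite setTI.
have fatx a : small {b | lt b a} -> forall s, (forall b, b \in s -> b = a \/ lt b a) -> fat (meet x s).
  (* A finite set of earlier stages has a last one, [b], so that the
     induction hypothesis at [b] covers it. *)
  elim/(well_founded_ind wf): a => a IH sa s sle.
  have fa (t : seq {b | lt b a}) : fat (meet (x \o sval) t).
    have [->|t0] := eqVneq t [::]; first by apply: fatS fatT.
    have [|b bt bm] := max_of_seq tr tot (_ : map sval t != [::]); first by case: (t) t0.
    have ba : lt b a by case/mapP: bt => b' _ ->; exact: (svalP b').
    have sb : small {b' | lt b' b}.
      apply: small_embeds sa; exists (fun b' => exist _ (sval b') (tr _ _ _ (svalP b') ba)).
      by move=> b1 b2 [] b12; exact: val_inj.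
    apply: fatS (IH b ba sb _ bm) => k kt b' b't; apply: kt.
    exact: map_f.
  have [fxa _] := goodx a sa fa.
  apply: fatS (fxa (pmap insub s)) => k [ka kt] b bs.
  have [->//|ba] := sle b bs.
  by apply: (kt (exist _ b ba)); rewrite mem_pmap_sub.
exists {a : W | `[< small {b | lt b a} >]}, (fun a => x (sval a)); split.
  move=> s; have [->|s0] := eqVneq s [::]; first by apply: fatS fatT.
  have [|b bs bm] := max_of_seq tr tot (_ : map sval s != [::]); first by case: (s) s0.
  have sb : small {b' | lt b' b} by case/mapP: bs => -[b' /= /asboolP sb'] _ ->.
  by apply: fatS (fatx b sb _ bm) => k kt a as_; apply: kt; exact: map_f.
move=> c cb; exists (f c).
have ec : e (sval (f c)) = c by rewrite -(eP _ c erefl).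
have [] := goodx (sval (f c)) (asboolW (svalP (f c))) _.
  move=> s; have sb := asboolW (svalP (f c)).
  have := fatx (sval (f c)) sb (map sval s).
  move=> h; apply: fatS (h _) => [k kt b bs|b]; first by apply: kt; exact: map_f.
  by move=> /mapP[b' _ ->]; right; exact: (svalP b').
by rewrite ec => _; apply.
Qed.

(** * The ultrafilter *)

Lemma partition_colouring (Q : set (set nat)) : finite_partition Q ->
  exists (h : set nat -> nat) (c : nat -> nat) (b : nat),
    [/\ forall k, (c k < b)%N, set_inj Q h & forall a k, Q a -> a k -> c k = h a].
Proof.
move=> [/finite_set_leP[b /pcard_leP/injfunPex[h hQ hinj]] [cover triv _]].
have /choice[p pP] : forall k, exists a, Q a /\ a k.
  by move=> k; have : [set: nat] k by []; rewrite -cover => -[a Qa ak]; exists a.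
exists h, (h \o p), b; split=> [k||a k Qa ak] /=.
- by have [Qp _] := pP k; exact: hQ.
- exact: hinj.
- by have [Qp pk] := pP k; congr (h _); apply: triv => //; exists k.
Qed.

(** A block met by [x] is determined by its colour, hence by the position of that
colour in [L]. *)
Lemma card_le_blocks_met (Q : set (set nat)) (h : set nat -> nat) (c : nat -> nat)
    (x : set nat) (L : seq nat) m :
    set_inj Q h -> (forall a k, Q a -> a k -> c k = h a) ->
    (size L <= m)%N -> (forall k, x k -> c k \in L) ->
  card_le [set a | Q a /\ x `&` a !=set0] `I_m.
Proof.
move=> hinj ch Lm cL.
have hL a : Q a -> x `&` a !=set0 -> h a \in L.
  by move=> Qa [k [xk ak]]; rewrite -(ch a k)// cL.
have [g] : $|{injfun [set a | Q a /\ x `&` a !=set0] >-> `I_m}|.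
  apply/injfunPex; exists (fun a => index (h a) L).
    by move=> a [Qa xa] /=; apply: leq_trans Lm; rewrite index_mem hL.
  move=> a a' /set_mem[Qa xa] /set_mem[Qa' xa'] e; apply: hinj; rewrite ?inE//.
  by rewrite -(nth_index 0 (hL a Qa xa)) e nth_index// hL.
exact: inj_card_le g.
Qed.

Theorem theorem3p14 : MA_sigma_linked ->
  exists U : set_system nat, laver_ultrafilter U /\ ~ scattered_ultrafilter U.
Proof.
move=> MA; have [S [x [fx xc]]] := laver_tower MA.
have [|||U [UU xU Ufat]] := @ultrafilter_of_fat (range (meet x)).
- by exists (meet x [::]); exists [::].
- by move=> _ [s _ <-].
- move=> _ _ [s _ <-] [t _ <-]; exists (meet x (s ++ t)); first by exists (s ++ t).
  by move=> k kst; split=> j js; apply: kst; rewrite mem_cat js ?orbT.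
have nU : nonprincipal_ultrafilter U by split=> // n /Ufat/fat1N.
exists U; split; last first.
  by move=> [_ /(_ bits)[A /Ufat fA /scattered_not_fat]].
split=> // Q Qpart.
have /choice[h hP] n := partition_colouring (Qpart n).
have /choice[c cP] := hP.
have [n|a laver_a] := xc c; first by have [b []] := cP n; exists b.
exists (x a).
  apply: filterS (xU (meet x [:: a]) (ex_intro2 _ _ [:: a] I erefl)) => k; apply.
  by rewrite inE.
move=> n; have [b [_ hinj ch]] := cP n; have [L [sL xL]] := laver_a n.
exact: card_le_blocks_met hinj ch sL xL.
Qed.
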